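(* Let $\mathscr{G}$ be a comonad on a bicategory $\mathscr{V}$ in $\mathrm{Caten}$. If $\mathscr{G}$ is left Hopf, then the forgetful pseudofunctor $\mathscr{U}:\mathscr{V}^{\mathscr{G}}\to\mathscr{V}$ creates left extensions.
   Context: Notation. For a bicategory $\mathscr V$, $\mathscr V_V^{V'}=\mathscr V(V,V')$ is the hom category; horizontal composition is written $\otimes$ (so $v'\otimes v:V\to V''$ for $v:V\to V'$, $v':V'\to V''$); coherence isomorphisms are suppressed. Comonads in Caten. ($\mathrm{Caten}$ is the tricategory of bicategories, 2-sided enriched categories, enriched functors and enriched natural transformations; what is needed here is the following.) A comonad $\mathscr G$ on $\mathscr V$ in $\mathrm{Caten}$ amounts to: a set $\mathrm{Ob}\mathscr G$ with a function $G\mapsto G_0\in\mathrm{Ob}\mathscr V$; endofunctors $\mathscr G_G^{G'}$ of $\mathscr V_{G_0}^{G'_0}$ for all $G,G'\in\mathrm{Ob}\mathscr G$ (indices are omitted when clear); and natural 2-cells $\mu_{v',v}:\mathscr G_{G'}^{G''}(v')\otimes\mathscr G_G^{G'}(v)\to\mathscr G_G^{G''}(v'\otimes v)$, $\eta_G:1_{G_0}\to\mathscr G_G^G(1_{G_0})$, $\mathrm d_v:\mathscr G_G^{G'}v\to\mathscr G_G^{G'}\mathscr G_G^{G'}v$, $\mathrm e_v:\mathscr G_G^{G'}v\to v$ such that $(\mu,\eta)$ is associative and unital, each $(\mathscr G_G^{G'},\mathrm e,\mathrm d)$ is a comonad, and $\mathrm e\mu=\mathrm e\otimes\mathrm e$,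 $\mathrm e\eta=1$, $\mathrm d\,\mu_{v',v}=\mathscr G(\mu_{v',v})\,\mu_{\mathscr Gv',\mathscr Gv}(\mathrm d\otimes\mathrm d)$, $\mathrm d\eta=\mathscr G(\eta)\eta$. The bicategory $\mathscr V^{\mathscr G}$ has objects $\mathrm{Ob}\mathscr G$ and hom categories $\mathscr V^{\mathscr G}(G,G')$ the Eilenberg–Moore coalgebras $(v,\gamma_v:v\to\mathscr G_G^{G'}v)$ for the comonad $\mathscr G_G^{G'}$ on $\mathscr V_{G_0}^{G'_0}$; identities are $(1_{G_0},\eta_G)$ and $(v',\gamma_{v'})\otimes(v,\gamma_v)=(v'\otimes v,\mu_{v',v}(\gamma_{v'}\otimes\gamma_v))$. The strict functor $\mathscr U:\mathscr V^{\mathscr G}\to\mathscr V$ sends $G$ to $G_0$ and forgets coactions. Hopf. For $v'\in\mathscr V(G'_0,G''_0)$ and $(v,\gamma_v)\in\mathscr V^{\mathscr G}(G,G')$ the left fusion operator is the 2-cell $\mathrm v^{\mathrm l}_{v',v}=\mu_{v',v}\circ(1\otimes\gamma_v):\mathscr G_{G'}^{G''}v'\otimes v\to\mathscr G_G^{G''}(v'\otimes v)$. $\mathscr G$ is left Hopf when all left fusion operators are invertible. Left extensions. In a bicategory, a 2-cell $\kappa:u\Rightarrow h\otimes v$ (with $u:U\to C$, $v:U\to V$, $h:V\to C$) exhibits $h$ as a left (Kan) extension of $u$ along $v$ when for each $w:V\to C$ and each 2-cell $\sigma:u\Rightarrow w\otimes v$ there is a unique 2-cell $\tau:h\Rightarrow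 w$ with $(\tau\otimes1_v)\kappa=\sigma$. A pseudofunctor $\mathscr H:\mathscr W\to\mathscr V$ creates left extensions when, for each span $C\xleftarrow{u}U\xrightarrow{v}V$ in $\mathscr W$ such that a left extension of $\mathscr Hu$ along $\mathscr Hv$ exists in $\mathscr V$, there exists a left extension of $u$ along $v$ in $\mathscr W$ which is taken by $\mathscr H$ to a left extension of $\mathscr Hu$ along $\mathscr Hv$. *)

(* Defs.v *)
From Stdlib Require Import ProofIrrelevance.
Set Implicit Arguments.
Unset Strict Implicit.
Unset Printing Implicit Defensive.

Declare Scope bicat_scope.
Delimit Scope bicat_scope with bicat.
Local Open Scope bicat_scope.

Reserved Notation "x ~> y" (at level 70, no associativity).
Reserved Notation "g ∘ f" (at level 40, left associativity).
Reserved Notation "y ⊗ x" (at level 35, right associativity).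
Reserved Notation "t ⊠ s" (at level 35, right associativity).

Record category := Category {
  obj :> Type;
  mor : obj -> obj -> Type;
  idm : forall x, mor x x;
  comp : forall x y z, mor y z -> mor x y -> mor x z;
  comp1m : forall x y (f : mor x y), comp (idm y) f = f;
  compm1 : forall x y (f : mor x y), comp f (idm x) = f;
  compA : forall w x y z (h : mor y z) (g : mor x y) (f : mor w x),
    comp h (comp g f) = comp (comp h g) f
}.
Arguments mor {c} x y.
Arguments idm {c} x.
Arguments comp {c x y z} g f : rename.

Notation "x ~> y" := (mor x y) : bicat_scope.
Notation "g ∘ f" := (comp g f) : bicat_scope.

Record functor (C D : category) := Functor {
  fobj :> C -> D;
  fmap : forall x y : C, x ~> y -> fobj x ~> fobj y;
  fmap1 : forall x : C, fmap (idm x) = idm (fobj x);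
  fmapM : forall (x y z : C) (g : y ~> z) (f : x ~> y),
    fmap (g ∘ f) = fmap g ∘ fmap f
}.
Arguments fmap {C D} F {x y} f : rename.

Record iso (C : category) (x y : C) := Iso {
  fwd : x ~> y;
  bwd : y ~> x;
  bwdK : bwd ∘ fwd = idm x;
  fwdK : fwd ∘ bwd = idm y
}.
Arguments fwd {C x y} i.
Arguments bwd {C x y} i.

Definition invertible (C : category) (x y : C) (f : x ~> y) : Prop :=
  exists g : y ~> x, g ∘ f = idm x /\ f ∘ g = idm y.

Definition idiso (C : category) (x : C) : iso x x :=
  Iso (comp1m (idm x)) (comp1m (idm x)).

Record comonad (C : category) := Comonad {
  cfun :> functor C C;
  counit : forall x : C, cfun x ~> x;
  comult : forall x : C, cfun x ~> cfun (cfun x);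
  counit_nat : forall (x y : C) (f : x ~> y),
    f ∘ counit x = counit y ∘ fmap cfun f;
  comult_nat : forall (x y : C) (f : x ~> y),
    fmap cfun (fmap cfun f) ∘ comult x = comult y ∘ fmap cfun f;
  counit_comult : forall x : C, counit (cfun x) ∘ comult x = idm (cfun x);
  fmap_counit_comult : forall x : C,
    fmap cfun (counit x) ∘ comult x = idm (cfun x);
  comult_comult : forall x : C,
    comult (cfun x) ∘ comult x = fmap cfun (comult x) ∘ comult x
}.
Arguments counit {C} T x : rename.
Arguments comult {C} T x : rename.

Record coalgebra (C : category) (T : comonad C) := Coalgebra {
  carrier : C;
  coact : carrier ~> T carrier;
  coact_counit : counit T carrier ∘ coact = idm carrier;
  coact_comult : comult T carrier ∘ coact = fmap T coact ∘ coact
}.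
Arguments carrier {C T} c.
Arguments coact {C T} c.

Record coalgebra_mor (C : category) (T : comonad C) (a b : coalgebra T) :=
  CoalgebraMor {
    under : carrier a ~> carrier b;
    under_coact : fmap T under ∘ coact a = coact b ∘ under
  }.
Arguments under {C T a b} c.

Lemma coalgebra_mor_eq (C : category) (T : comonad C) (a b : coalgebra T)
  (f g : coalgebra_mor a b) : under f = under g -> f = g.
Proof.
destruct f as [f pf], g as [g pg]; simpl; intros e; subst g.
now rewrite (proof_irrelevance _ pf pg).
Qed.

Section CoalgebraCategory.
Variables (C : category) (T : comonad C).

Lemma coalgebra_id_subproof (a : coalgebra T) :
  fmap T (idm (carrier a)) ∘ coact a = coact a ∘ idm (carrier a).
Proof. now rewrite fmap1, comp1m, compm1. Qed.

Lemma coalgebra_comp_subproof (a b c : coalgebra T)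
  (g : coalgebra_mor b c) (f : coalgebra_mor a b) :
  fmap T (under g ∘ under f) ∘ coact a = coact c ∘ (under g ∘ under f).
Proof.
now rewrite fmapM, <- compA, (under_coact f), compA, (under_coact g), compA.
Qed.

Definition coalgebra_category : category.
Proof.
refine (@Category (coalgebra T) (@coalgebra_mor C T)
  (fun a => CoalgebraMor (coalgebra_id_subproof a))
  (fun a b c g f => CoalgebraMor (coalgebra_comp_subproof g f)) _ _ _).
- intros a b f; apply coalgebra_mor_eq, comp1m.
- intros a b f; apply coalgebra_mor_eq, compm1.
- intros a b c d h g f; apply coalgebra_mor_eq, compA.
Defined.

Definition coalgebra_forget : functor coalgebra_category C :=
  @Functor coalgebra_category C (fun a => carrier a) (fun a b f => under f)
    (fun a => eq_refl) (fun a b c g f => eq_refl).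

End CoalgebraCategory.

(* [tens] and [tens2] are the actions of the horizontal composition functor
   [hom b c * hom a b -> hom a c] on objects and on morphisms. *)

Record bicategory := Bicategory {
  ob :> Type;
  hom : ob -> ob -> category;
  one : forall a, hom a a;
  tens : forall a b c, hom b c -> hom a b -> hom a c;
  tens2 : forall a b c (y y' : hom b c) (x x' : hom a b),
    y ~> y' -> x ~> x' -> tens y x ~> tens y' x';
  tens2_id : forall a b c (y : hom b c) (x : hom a b),
    tens2 (idm y) (idm x) = idm (tens y x);
  tens2_comp : forall a b c (y y' y'' : hom b c) (x x' x'' : hom a b)
    (t' : y' ~> y'') (t : y ~> y') (s' : x' ~> x'') (s : x ~> x'),
    tens2 (t' ∘ t) (s' ∘ s) = tens2 t' s' ∘ tens2 t s;
  assoc : forall a b c d (z : hom c d) (y : hom b c) (x : hom a b),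
    iso (tens (tens z y) x) (tens z (tens y x));
  assoc_nat : forall a b c d (z z' : hom c d) (y y' : hom b c)
    (x x' : hom a b) (r : z ~> z') (t : y ~> y') (s : x ~> x'),
    tens2 r (tens2 t s) ∘ fwd (assoc z y x)
    = fwd (assoc z' y' x') ∘ tens2 (tens2 r t) s;
  lunit : forall a b (x : hom a b), iso (tens (one b) x) x;
  lunit_nat : forall a b (x x' : hom a b) (s : x ~> x'),
    s ∘ fwd (lunit x) = fwd (lunit x') ∘ tens2 (idm (one b)) s;
  runit : forall a b (x : hom a b), iso (tens x (one a)) x;
  runit_nat : forall a b (x x' : hom a b) (s : x ~> x'),
    s ∘ fwd (runit x) = fwd (runit x') ∘ tens2 s (idm (one a));
  pentagon : forall a b c d e (w : hom d e) (z : hom c d) (y : hom b c)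
    (x : hom a b),
    fwd (assoc w z (tens y x)) ∘ fwd (assoc (tens w z) y x)
    = tens2 (idm w) (fwd (assoc z y x))
      ∘ (fwd (assoc w (tens z y) x) ∘ tens2 (fwd (assoc w z y)) (idm x));
  triangle : forall a b c (y : hom b c) (x : hom a b),
    tens2 (idm y) (fwd (lunit x)) ∘ fwd (assoc y (one b) x)
    = tens2 (fwd (runit y)) (idm x)
}.
Arguments hom {b} a b : rename.
Arguments one {b} a : rename.
Arguments tens {b a b0 c} y x : rename.
Arguments tens2 {b a b0 c y y' x x'} t s : rename.
Arguments assoc {b a b0 c d} z y x : rename.
Arguments lunit {b a b0} x : rename.
Arguments runit {b a b0} x : rename.

Notation "y ⊗ x" := (tens y x) : bicat_scope.
Notation "t ⊠ s" := (tens2 t s) : bicat_scope.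

Lemma tens2_compl (V : bicategory) (a b c : V) (y y' y'' : hom b c)
  (x x' : hom a b) (t' : y' ~> y'') (t : y ~> y') (s : x ~> x') :
  (t' ∘ t) ⊠ s = (t' ⊠ idm x') ∘ (t ⊠ s).
Proof. now rewrite <- tens2_comp, comp1m. Qed.

Lemma tens2_compr (V : bicategory) (a b c : V) (y y' : hom b c)
  (x x' x'' : hom a b) (t : y ~> y') (s' : x' ~> x'') (s : x ~> x') :
  t ⊠ (s' ∘ s) = (idm y' ⊠ s') ∘ (t ⊠ s).
Proof. now rewrite <- tens2_comp, comp1m. Qed.

Record pseudofunctor (W V : bicategory) := Pseudofunctor {
  pob :> W -> V;
  phom : forall a b : W, functor (hom a b) (hom (pob a) (pob b));
  pone : forall a : W, iso (one (pob a)) (phom a a (one a));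
  ptens : forall (a b c : W) (y : hom b c) (x : hom a b),
    iso (phom b c y ⊗ phom a b x) (phom a c (y ⊗ x));
  ptens_nat : forall (a b c : W) (y y' : hom b c) (x x' : hom a b)
    (t : y ~> y') (s : x ~> x'),
    fmap (phom a c) (t ⊠ s) ∘ fwd (ptens y x)
    = fwd (ptens y' x') ∘ (fmap (phom b c) t ⊠ fmap (phom a b) s);
  ptens_assoc : forall (a b c d : W) (z : hom c d) (y : hom b c)
    (x : hom a b),
    fwd (ptens z (y ⊗ x))
      ∘ ((idm (phom c d z) ⊠ fwd (ptens y x))
         ∘ fwd (assoc (phom c d z) (phom b c y) (phom a b x)))
    = fmap (phom a d) (fwd (assoc z y x))
      ∘ (fwd (ptens (z ⊗ y) x) ∘ (fwd (ptens z y) ⊠ idm (phom a b x)));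
  ptens_lunit : forall (a b : W) (x : hom a b),
    fmap (phom a b) (fwd (lunit x))
      ∘ (fwd (ptens (one b) x) ∘ (fwd (pone b) ⊠ idm (phom a b x)))
    = fwd (lunit (phom a b x));
  ptens_runit : forall (a b : W) (x : hom a b),
    fmap (phom a b) (fwd (runit x))
      ∘ (fwd (ptens x (one a)) ∘ (idm (phom a b x) ⊠ fwd (pone a)))
    = fwd (runit (phom a b x))
}.
Arguments phom {W V} H {a b} : rename.
Arguments ptens {W V} H {a b c} y x : rename.

Definition is_left_extension (V : bicategory) (U B C : V)
  (u : hom U C) (v : hom U B) (h : hom B C) (kappa : u ~> h ⊗ v) : Prop :=
  forall (w : hom B C) (sigma : u ~> w ⊗ v),
  exists! tau : h ~> w, (tau ⊠ idm v) ∘ kappa = sigma.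

Definition creates_left_extensions (W V : bicategory)
  (H : pseudofunctor W V) : Prop :=
  forall (U B C : W) (u : hom U C) (v : hom U B),
  (exists (k : hom (H B) (H C)) (kappa : phom H u ~> k ⊗ phom H v),
      is_left_extension kappa) ->
  exists (h : hom B C) (kappa : u ~> h ⊗ v),
    is_left_extension kappa /\
    is_left_extension (bwd (ptens H h v) ∘ fmap (phom H) kappa).

Record caten_comonad (V : bicategory) := CatenComonad {
  gob : Type;
  gob0 : gob -> V;
  gcom : forall G G' : gob, comonad (hom (gob0 G) (gob0 G'));
  gmu : forall (G G' G'' : gob) (v' : hom (gob0 G') (gob0 G''))
    (v : hom (gob0 G) (gob0 G')),
    gcom G' G'' v' ⊗ gcom G G' v ~> gcom G G'' (v' ⊗ v);
  geta : forall G : gob, one (gob0 G) ~> gcom G G (one (gob0 G));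
  gmu_nat : forall (G G' G'' : gob) (v' w' : hom (gob0 G') (gob0 G''))
    (v w : hom (gob0 G) (gob0 G')) (t : v' ~> w') (s : v ~> w),
    fmap (gcom G G'') (t ⊠ s) ∘ gmu v' v
    = gmu w' w ∘ (fmap (gcom G' G'') t ⊠ fmap (gcom G G') s);
  gmu_assoc : forall (G G' G'' G''' : gob) (v'' : hom (gob0 G'') (gob0 G'''))
    (v' : hom (gob0 G') (gob0 G'')) (v : hom (gob0 G) (gob0 G')),
    gmu v'' (v' ⊗ v)
      ∘ ((idm (gcom G'' G''' v'') ⊠ gmu v' v)
         ∘ fwd (assoc (gcom G'' G''' v'') (gcom G' G'' v') (gcom G G' v)))
    = fmap (gcom G G''') (fwd (assoc v'' v' v))
      ∘ (gmu (v'' ⊗ v') v ∘ (gmu v'' v' ⊠ idm (gcom G G' v)));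
  gmu_lunit : forall (G G' : gob) (v : hom (gob0 G) (gob0 G')),
    fmap (gcom G G') (fwd (lunit v))
      ∘ (gmu (one (gob0 G')) v ∘ (geta G' ⊠ idm (gcom G G' v)))
    = fwd (lunit (gcom G G' v));
  gmu_runit : forall (G G' : gob) (v : hom (gob0 G) (gob0 G')),
    fmap (gcom G G') (fwd (runit v))
      ∘ (gmu v (one (gob0 G)) ∘ (idm (gcom G G' v) ⊠ geta G))
    = fwd (runit (gcom G G' v));
  counit_gmu : forall (G G' G'' : gob) (v' : hom (gob0 G') (gob0 G''))
    (v : hom (gob0 G) (gob0 G')),
    counit (gcom G G'') (v' ⊗ v) ∘ gmu v' v
    = counit (gcom G' G'') v' ⊠ counit (gcom G G') v;
  counit_geta : forall G : gob,
    counit (gcom G G) (one (gob0 G)) ∘ geta G = idm (one (gob0 G));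
  comult_gmu : forall (G G' G'' : gob) (v' : hom (gob0 G') (gob0 G''))
    (v : hom (gob0 G) (gob0 G')),
    comult (gcom G G'') (v' ⊗ v) ∘ gmu v' v
    = fmap (gcom G G'') (gmu v' v)
      ∘ (gmu (gcom G' G'' v') (gcom G G' v)
         ∘ (comult (gcom G' G'') v' ⊠ comult (gcom G G') v));
  comult_geta : forall G : gob,
    comult (gcom G G) (one (gob0 G)) ∘ geta G
    = fmap (gcom G G) (geta G) ∘ geta G
}.
Arguments gob {V} c.
Arguments gob0 {V} c g.
Arguments gcom {V} c {G G'} : rename.
Arguments gmu {V} c {G G' G''} v' v : rename.
Arguments geta {V} c G : rename.

Section CoalgebraBicategory.
Variables (V : bicategory) (T : caten_comonad V).

Definition chom (G G' : gob T) : category :=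
  coalgebra_category (@gcom V T G G').

Definition cunit (G : gob T) : chom G G :=
  @Coalgebra _ (@gcom V T G G) (one (gob0 T G)) (geta T G)
    (counit_geta G) (comult_geta G).

Section Tensor.
Variables (G G' G'' : gob T).

Lemma ctens_counit (y : chom G' G'') (x : chom G G') :
  counit (gcom T) (carrier y ⊗ carrier x)
    ∘ (gmu T (carrier y) (carrier x) ∘ (coact y ⊠ coact x))
  = idm (carrier y ⊗ carrier x).
Proof.
now rewrite compA, counit_gmu, <- tens2_comp, !coact_counit, tens2_id.
Qed.

Lemma ctens_comult (y : chom G' G'') (x : chom G G') :
  comult (gcom T) (carrier y ⊗ carrier x)
    ∘ (gmu T (carrier y) (carrier x) ∘ (coact y ⊠ coact x))
  = fmap (gcom T) (gmu T (carrier y) (carrier x) ∘ (coact y ⊠ coact x))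
    ∘ (gmu T (carrier y) (carrier x) ∘ (coact y ⊠ coact x)).
Proof.
rewrite compA, comult_gmu, <- !compA, <- tens2_comp, !coact_comult.
now rewrite tens2_comp, fmapM, <- compA, (compA (gmu _ _ _)), <- gmu_nat,
  !compA.
Qed.

Definition ctens (y : chom G' G'') (x : chom G G') : chom G G'' :=
  @Coalgebra _ (@gcom V T G G'') (carrier y ⊗ carrier x)
    (gmu T (carrier y) (carrier x) ∘ (coact y ⊠ coact x))
    (ctens_counit y x) (ctens_comult y x).

Lemma ctens2_subproof (y y' : chom G' G'') (x x' : chom G G')
  (t : y ~> y') (s : x ~> x') :
  fmap (gcom T) (under t ⊠ under s) ∘ coact (ctens y x)
  = coact (ctens y' x') ∘ (under t ⊠ under s).
Proof.
simpl; rewrite compA, gmu_nat, <- !compA, <- !tens2_comp.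
now rewrite (under_coact t), (under_coact s).
Qed.

Definition ctens2 (y y' : chom G' G'') (x x' : chom G G')
  (t : y ~> y') (s : x ~> x') : ctens y x ~> ctens y' x' :=
  @CoalgebraMor _ (@gcom V T G G'') (ctens y x) (ctens y' x')
    (under t ⊠ under s) (ctens2_subproof t s).

End Tensor.

Lemma coalgebra_inv_subproof (G G' : gob T) (a b : chom G G')
  (f : iso (carrier a) (carrier b)) :
  fmap (gcom T) (fwd f) ∘ coact a = coact b ∘ fwd f ->
  fmap (gcom T) (bwd f) ∘ coact b = coact a ∘ bwd f.
Proof.
intros hf.
rewrite <- (compm1 (coact b)), <- (fwdK f), (compA (coact b)), <- hf.
now rewrite !compA, <- fmapM, bwdK, fmap1, comp1m.
Qed.

Definition coalgebra_iso (G G' : gob T) (a b : chom G G')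
  (f : iso (carrier a) (carrier b))
  (hf : fmap (gcom T) (fwd f) ∘ coact a = coact b ∘ fwd f) : iso a b.
Proof.
refine (@Iso (chom G G') a b
  (@CoalgebraMor _ (@gcom V T G G') a b (fwd f) hf)
  (@CoalgebraMor _ (@gcom V T G G') b a (bwd f) (coalgebra_inv_subproof hf))
  _ _); apply coalgebra_mor_eq.
- apply bwdK.
- apply fwdK.
Defined.

Lemma cassoc_subproof (G G' G'' G''' : gob T) (z : chom G'' G''')
  (y : chom G' G'') (x : chom G G') :
  fmap (gcom T) (fwd (assoc (carrier z) (carrier y) (carrier x)))
    ∘ coact (ctens (ctens z y) x)
  = coact (ctens z (ctens y x))
    ∘ fwd (assoc (carrier z) (carrier y) (carrier x)).
Proof.
simpl.
rewrite tens2_compl, tens2_compr, (compA (gmu _ _ _)), (compA (fmap _ _)).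
now rewrite <- gmu_assoc, <- !compA, assoc_nat.
Qed.

Lemma clunit_subproof (G G' : gob T) (x : chom G G') :
  fmap (gcom T) (fwd (lunit (carrier x))) ∘ coact (ctens (cunit G') x)
  = coact x ∘ fwd (lunit (carrier x)).
Proof.
simpl.
rewrite lunit_nat, <- gmu_lunit, <- !compA, <- tens2_comp.
now rewrite comp1m, compm1.
Qed.

Lemma crunit_subproof (G G' : gob T) (x : chom G G') :
  fmap (gcom T) (fwd (runit (carrier x))) ∘ coact (ctens x (cunit G))
  = coact x ∘ fwd (runit (carrier x)).
Proof.
simpl.
rewrite runit_nat, <- gmu_runit, <- !compA, <- tens2_comp.
now rewrite comp1m, compm1.
Qed.

Definition cassoc (G G' G'' G''' : gob T) (z : chom G'' G''')
  (y : chom G' G'') (x : chom G G') :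
  iso (ctens (ctens z y) x) (ctens z (ctens y x)) :=
  @coalgebra_iso _ _ (ctens (ctens z y) x) (ctens z (ctens y x)) _
    (cassoc_subproof z y x).

Definition clunit (G G' : gob T) (x : chom G G') : iso (ctens (cunit G') x) x :=
  @coalgebra_iso _ _ (ctens (cunit G') x) x _ (clunit_subproof x).

Definition crunit (G G' : gob T) (x : chom G G') : iso (ctens x (cunit G)) x :=
  @coalgebra_iso _ _ (ctens x (cunit G)) x _ (crunit_subproof x).

Definition coalgebra_bicategory : bicategory.
Proof.
refine (@Bicategory (gob T) chom cunit ctens ctens2 _ _
  cassoc _ clunit _ crunit _ _ _);
  intros; apply coalgebra_mor_eq; simpl.
- apply tens2_id.
- apply tens2_comp.
- apply assoc_nat.
- apply lunit_nat.
- apply runit_nat.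
- apply pentagon.
- apply triangle.
Defined.

(* The forgetful pseudofunctor is strict: its comparison 2-cells are
   identities. *)
Definition forgetful : pseudofunctor coalgebra_bicategory V.
Proof.
refine (@Pseudofunctor coalgebra_bicategory V (gob0 T)
  (fun G G' => coalgebra_forget (@gcom V T G G'))
  (fun G => idiso (one (gob0 T G)))
  (fun _ _ _ y x => idiso (carrier y ⊗ carrier x)) _ _ _ _);
  intros; simpl.
- now rewrite compm1, comp1m.
- now rewrite !tens2_id, !comp1m, !compm1.
- now rewrite !tens2_id, !compm1.
- now rewrite !tens2_id, !compm1.
Defined.

Definition left_fusion (G G' G'' : gob T)
  (v' : hom (gob0 T G') (gob0 T G''))
  (v : @hom coalgebra_bicategory G G') :
  gcom T v' ⊗ carrier v ~> gcom T (v' ⊗ carrier v) :=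
  gmu T v' (carrier v) ∘ (idm (gcom T v') ⊠ coact v).

Definition left_hopf : Prop :=
  forall (G G' G'' : gob T) (v' : hom (gob0 T G') (gob0 T G''))
    (v : @hom coalgebra_bicategory G G'),
  invertible (left_fusion v' v).

End CoalgebraBicategory.

(* Main.v *)
(** Fix an extension [kappa : u ~> k ⊗ v] of the underlying 1-cells.  Since the
    fusion operator [k, v] is invertible, the universal property yields a unique
    2-cell [gamma : k ~> G k] making [kappa] compatible with the coactions:
    [fusion ∘ (gamma ⊠ 1) ∘ kappa = G kappa ∘ coact u].  The coalgebra laws for
    [gamma], and the fact that a comparison 2-cell [k ~> w] induced by a
    coalgebra map is again a coalgebra map, are equations between 2-cells out of
    [k]; they may be checked after whiskering with [v], restricting along
    [kappa] and composing with invertible fusion operators, where they become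
    the corresponding equations for [u]. *)
Require Import Defs.

Set Implicit Arguments.
Unset Strict Implicit.
Unset Printing Implicit Defensive.
Local Open Scope bicat_scope.

Lemma invertible_mono (C : category) (w x y : C) (m : x ~> y) (f g : w ~> x) :
  invertible m -> m ∘ f = m ∘ g -> f = g.
Proof.
intros [n [nm _]] e.
now rewrite <- (comp1m f), <- (comp1m g), <- nm, <- !compA, e.
Qed.

Lemma invertible_comp (C : category) (x y z : C) (g : y ~> z) (f : x ~> y) :
  invertible g -> invertible f -> invertible (g ∘ f).
Proof.
intros [g' [g'g gg']] [f' [f'f ff']]; exists (f' ∘ g'); split.
- now rewrite <- compA, (compA g'), g'g, comp1m.
- now rewrite <- compA, (compA f), ff', comp1m.
Qed.

Lemma invertible_fmap (C D : category) (F : functor C D) (x y : C)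
  (f : x ~> y) : invertible f -> invertible (fmap F f).
Proof.
intros [g [gf fg]]; exists (fmap F g).
now rewrite <- !fmapM, gf, fg, !fmap1.
Qed.

(** Cancelling [m] makes [f] and [g] factor the same 2-cell through [kappa], so uniqueness
    identifies them. *)
Lemma left_extension_mono (V : bicategory) (U B C : V) (u : hom U C)
  (v : hom U B) (k : hom B C) (kappa : u ~> k ⊗ v) (w : hom B C)
  (x : hom U C) (m : w ⊗ v ~> x) (f g : k ~> w) :
  is_left_extension kappa -> invertible m ->
  m ∘ ((f ⊠ idm v) ∘ kappa) = m ∘ ((g ⊠ idm v) ∘ kappa) -> f = g.
Proof.
intros ext minv e.
apply (invertible_mono minv) in e.
destruct (ext w ((g ⊠ idm v) ∘ kappa)) as [t [_ uniq]].
now rewrite <- (uniq f e), <- (uniq g eq_refl).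
Qed.

Lemma left_fusion_nat (V : bicategory) (T : caten_comonad V) (A B C : gob T)
  (w w' : hom (gob0 T B) (gob0 T C)) (t : w ~> w') (v : chom A B) :
  left_fusion w' v ∘ (fmap (gcom T) t ⊠ idm (carrier v))
  = fmap (gcom T) (t ⊠ idm (carrier v)) ∘ left_fusion w v.
Proof.
unfold left_fusion.
rewrite (compA (fmap _ _)), gmu_nat, fmap1, <- !compA, <- !tens2_comp.
now rewrite !comp1m, !compm1.
Qed.

Lemma counit_left_fusion (V : bicategory) (T : caten_comonad V)
  (A B C : gob T) (w : hom (gob0 T B) (gob0 T C)) (v : chom A B) :
  counit (gcom T) (w ⊗ carrier v) ∘ left_fusion w v
  = counit (gcom T) w ⊠ idm (carrier v).
Proof.
unfold left_fusion.
now rewrite compA, counit_gmu, <- tens2_comp, compm1, coact_counit.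
Qed.

(** After [comult_gmu], coassociativity of [v] replaces its comultiplication by a second coaction,
    which naturality of [gmu] absorbs into the outer fusion operator. *)
Lemma comult_left_fusion (V : bicategory) (T : caten_comonad V)
  (A B C : gob T) (w : hom (gob0 T B) (gob0 T C)) (v : chom A B) :
  comult (gcom T) (w ⊗ carrier v) ∘ left_fusion w v
  = (fmap (gcom T) (left_fusion w v) ∘ left_fusion (gcom T w) v)
    ∘ (comult (gcom T) w ⊠ idm (carrier v)).
Proof.
unfold left_fusion.
rewrite compA, comult_gmu, fmapM, <- !compA, (compA (fmap _ (_ ⊠ _))).
rewrite gmu_nat, fmap1, <- !compA, <- !tens2_comp.
now rewrite !comp1m, !compm1, coact_comult.
Qed.

(** Through this identity, the equation defining [gamma] says that [kappa] is a coalgebra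
    morphism. *)
Lemma ctens_coact_fusion (V : bicategory) (T : caten_comonad V)
  (A B C : gob T) (w : chom B C) (v : chom A B) :
  coact (ctens w v)
  = left_fusion (carrier w) v ∘ (coact w ⊠ idm (carrier v)).
Proof.
simpl; unfold left_fusion.
now rewrite <- compA, <- tens2_comp, comp1m, compm1.
Qed.

Lemma extension_coaction (V : bicategory) (T : caten_comonad V)
  (A B C : gob T) (u : chom A C) (v : chom A B)
  (k : hom (gob0 T B) (gob0 T C)) (kappa : carrier u ~> k ⊗ carrier v) :
  left_hopf T -> is_left_extension kappa ->
  exists gamma : k ~> gcom T k,
    left_fusion k v ∘ ((gamma ⊠ idm (carrier v)) ∘ kappa)
    = fmap (gcom T) kappa ∘ coact u.
Proof.
intros hopf ext.
destruct (hopf A B C k v) as [f [_ fK]].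
(* The inverse [f] of fusion brings the target into the form [gcom T k ⊗ carrier v], to which the
   universal property applies. *)
destruct (ext _ (f ∘ (fmap (gcom T) kappa ∘ coact u))) as [gamma [e _]].
exists gamma.
now rewrite e, compA, fK, comp1m.
Qed.

Lemma extension_coaction_counit (V : bicategory) (T : caten_comonad V)
  (A B C : gob T) (u : chom A C) (v : chom A B)
  (k : hom (gob0 T B) (gob0 T C)) (kappa : carrier u ~> k ⊗ carrier v)
  (gamma : k ~> gcom T k) :
  is_left_extension kappa ->
  left_fusion k v ∘ ((gamma ⊠ idm (carrier v)) ∘ kappa)
    = fmap (gcom T) kappa ∘ coact u ->
  counit (gcom T) k ∘ gamma = idm k.
Proof.
intros ext e.
(* The identity suffices as [m]: by [counit_left_fusion], the counit absorbs the fusion operator. *)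
apply (left_extension_mono (m := idm (k ⊗ carrier v)) ext).
- exists (idm _); now rewrite comp1m.
- rewrite !comp1m, tens2_id, comp1m, tens2_compl, <- counit_left_fusion.
  rewrite <- !compA, e, compA, <- counit_nat, <- compA.
  now rewrite coact_counit, compm1.
Qed.

Lemma extension_coaction_comult (V : bicategory) (T : caten_comonad V)
  (A B C : gob T) (u : chom A C) (v : chom A B)
  (k : hom (gob0 T B) (gob0 T C)) (kappa : carrier u ~> k ⊗ carrier v)
  (gamma : k ~> gcom T k) :
  left_hopf T -> is_left_extension kappa ->
  left_fusion k v ∘ ((gamma ⊠ idm (carrier v)) ∘ kappa)
    = fmap (gcom T) kappa ∘ coact u ->
  comult (gcom T) k ∘ gamma = fmap (gcom T) gamma ∘ gamma.
Proof.
intros hopf ext e.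
apply (left_extension_mono
  (m := fmap (gcom T) (left_fusion k v) ∘ left_fusion (gcom T k) v) ext).
- apply invertible_comp; [apply invertible_fmap |]; apply hopf.
- rewrite !tens2_compl.
  (* The [comult] side reaches this value by coassociativity of [u], the other by using [e] twice,
     once under [gcom T]. *)
  transitivity (fmap (gcom T) (fmap (gcom T) kappa ∘ coact u) ∘ coact u).
  + rewrite <- (compA (comult _ _ ⊠ _)), (compA _ (comult _ _ ⊠ _)).
    rewrite <- comult_left_fusion, <- compA, e, compA, <- comult_nat.
    now rewrite fmapM, <- !compA, coact_comult.
  + rewrite <- e, !fmapM, <- !compA, <- e.
    rewrite (compA (left_fusion (gcom T k) v)), left_fusion_nat.
    now rewrite <- !compA.
Qed.

(** Whiskered, restricted along [kappa] and followed by fusion at [w], both sides become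
    [fmap (gcom T) sigma ∘ coact u]. *)
Lemma extension_comparison_coact (V : bicategory) (T : caten_comonad V)
  (A B C : gob T) (u : chom A C) (v : chom A B) (k w : chom B C)
  (kappa : carrier u ~> carrier k ⊗ carrier v)
  (sigma : carrier u ~> carrier w ⊗ carrier v)
  (tau : carrier k ~> carrier w) :
  left_hopf T -> is_left_extension kappa ->
  left_fusion (carrier k) v ∘ ((coact k ⊠ idm (carrier v)) ∘ kappa)
    = fmap (gcom T) kappa ∘ coact u ->
  left_fusion (carrier w) v ∘ ((coact w ⊠ idm (carrier v)) ∘ sigma)
    = fmap (gcom T) sigma ∘ coact u ->
  (tau ⊠ idm (carrier v)) ∘ kappa = sigma ->
  fmap (gcom T) tau ∘ coact k = coact w ∘ tau.
Proof.
intros hopf ext ek es e.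
apply (left_extension_mono ext (hopf A B C (carrier w) v)).
rewrite !tens2_compl, <- !compA, e, es, (compA (left_fusion _ _)).
now rewrite left_fusion_nat, <- compA, ek, compA, <- fmapM, e.
Qed.

Theorem theorem8p1 (V : bicategory) (G : caten_comonad V) :
  left_hopf G -> creates_left_extensions (forgetful G).
Proof.
intros hopf A B C u v [k [kappa ext]].
change (obj (chom A C)) in u; change (obj (chom A B)) in v.
change (obj (hom (gob0 G B) (gob0 G C))) in k.
change (carrier u ~> k ⊗ carrier v) in kappa.
destruct (extension_coaction hopf ext) as [gamma e].
pose (h := @Coalgebra _ (@gcom V G B C) k gamma
  (extension_coaction_counit ext e) (extension_coaction_comult hopf ext e)
  : chom B C).
assert (e' : fmap (gcom G) kappa ∘ coact u = coact (ctens h v) ∘ kappa).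
{ now rewrite ctens_coact_fusion, <- compA. }
pose (kappa' := @CoalgebraMor _ (@gcom V G A C) u (ctens h v) kappa e'
  : u ~> ctens h v).
exists h, kappa'; split.
- intros w sigma.
  change (obj (chom B C)) in w; change (u ~> ctens w v) in sigma.
  (* The factorization is found in [V] and then lifted; uniqueness descends because [under] is
     faithful. *)
  destruct (ext (carrier w) (under sigma)) as [tau [te uniq]].
  assert (es : left_fusion (carrier w) v
      ∘ ((coact w ⊠ idm (carrier v)) ∘ under sigma)
    = fmap (gcom G) (under sigma) ∘ coact u).
  { rewrite compA, <- ctens_coact_fusion.
    exact (eq_sym (under_coact sigma)). }
  exists (@CoalgebraMor _ (@gcom V G B C) h w tau
    (extension_comparison_coact (k := h) hopf ext e es te)); split.
  + now apply coalgebra_mor_eq.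
  + intros t et; apply coalgebra_mor_eq, uniq.
    exact (f_equal (@under _ _ _ _) et).
(* The comparison 2-cell of [forgetful] is an identity, so this is [ext] itself. *)
- simpl; now rewrite comp1m.
Qed.
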